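(* Let $c \in \mathbb{R}^n$, let $Q$ be a real symmetric $n \times n$ matrix, let $\sigma > 0$, and let $m(s) = c^T s + \frac12 s^T Q s + \frac13 \sigma \|s\|^3$ for $s \in \mathbb{R}^n$. Given $\bar s \in \mathbb{R}^n$ (not necessarily a stationary point of $m$) define a point $\hat s$ as follows: (a) if $c^T \bar s > 0$, then $\hat s := -\bar s$; (b) if $c^T \bar s \le 0$ and, for some $\epsilon_2 \in \mathbb{R}$, a vector $d \in \mathbb{R}^n$ exists such that $d^T (Q + \sigma \|\bar s\| I) d < -\epsilon_2 \|d\|^2$, then, for such a $d$: (i) if $\bar s = 0$ and $\epsilon_2 \ge 0$, then, assuming without loss of generality (replacing $d$ by $-d$ if necessary) that $c^T d \le 0$, $$\hat s := \bar s + \alpha d, \quad \text{with any } \alpha \text{ such that } 0 < \alpha < -\frac{3\, d^T Q d}{2\, \sigma \|d\|^3};$$ (ii) if $\bar s \neq 0$, $\bar s^T d \neq 0$ and $\epsilon_2 \ge \left| \frac{\nabla m(\bar s)^T d}{\bar s^T d} \right|$, then $$\hat s := \bar s - 2 \frac{\bar s^T d}{\|d\|^2} d;$$ (iii) if $\bar s \neq 0$, $\bar s^T d = 0$ and $\epsilon_2 > \frac{|\nabla m(\bar s)^T \bar s|}{\|\bar s\|^2}$, then, assuming without loss of generality (replacing $d$ by $-d$ if necessary) that $\nabla m(\bar s)^T d \ge 0$, $$\hat s := \bar s - 2 \frac{\bar s^T z}{\|z\|^2} z,$$ where $z := \bar s + \alpha d$ and $\alpha > 0$ is sufficiently large to satisfy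 $$z^T (Q + \sigma \|\bar s\| I) z < -\epsilon_2 \|z\|^2.$$ Then, in each of these cases, $m(\hat s) < m(\bar s)$.
   Context: $\|\cdot\|$ is the Euclidean norm and $I$ is the $n \times n$ identity matrix. The gradient of $m$ is $\nabla m(s) = c + Q s + \sigma \|s\| s$. *)

(* Defs.v *)
From HB Require Import structures.
From mathcomp Require Import all_boot all_order all_algebra.
From mathcomp Require Import all_classical all_reals all_analysis.
Import Order.TTheory GRing.Theory Num.Theory.
Import numFieldNormedType.Exports.

Set Implicit Arguments.
Unset Strict Implicit.
Unset Printing Implicit Defensive.

Local Open Scope ring_scope.

Definition dot (R : realType) (n : nat) (u v : 'cV[R]_n) : R :=
  (u^T *m v) 0 0.

(* The norm [`|s|] that MathComp-Analysis puts on matrices is the sup norm. *)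
Definition enorm (R : realType) (n : nat) (s : 'cV[R]_n) : R :=
  Num.sqrt (dot s s).

Definition model (R : realType) (n : nat) (c : 'cV[R]_n) (Q : 'M[R]_n)
    (sigma : R) (s : 'cV[R]_n) : R :=
  dot c s + 2^-1 * dot s (Q *m s) + 3^-1 * sigma * enorm s ^+ 3.

(* The column of partial derivatives of f at s. *)
Definition grad (R : realType) (n : nat) (f : 'cV[R]_n -> R) (s : 'cV[R]_n) :
    'cV[R]_n :=
  \col_(i < n) 'D_(delta_mx i 0) f s.

Definition neg_curv (R : realType) (n : nat) (Q : 'M[R]_n) (sigma : R)
    (sbar : 'cV[R]_n) (eps2 : R) (d : 'cV[R]_n) : Prop :=
  dot d ((Q + (sigma * enorm sbar)%:M) *m d) < - eps2 * enorm d ^+ 2.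

(* Main.v *)
Require Import Defs.
From mathcomp Require Import all_boot all_order all_algebra.
From mathcomp Require Import all_classical all_reals all_analysis.
From mathcomp Require Import ring lra.
Import Order.TTheory GRing.Theory Num.Theory.
Import numFieldNormedType.Exports.
Local Open Scope ring_scope.

(* Replacing s by its reflection s - 2 (s.d / |d|^2) d preserves |s|, so the cubic
   term of m does not change. With t = - 2 s.d / |d|^2, the identity
   t^2 |d|^2 = - 2 t (s.d) turns the remaining quadratic change into
   t (grad m(s).d) + t^2/2 d^T (Q + sigma |s| I) d, which by negative curvature is
   less than t (s.d) (grad m(s).d / s.d + eps2); here t (s.d) < 0. In case (iii) one
   has s.z = |s|^2 and grad m(s).z >= grad m(s).s, so this bound applies to z. *)

Section CubicModel.
Set Implicit Arguments.
Unset Strict Implicit.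
Context {R : realType} {n : nat}.
Implicit Types (u v w s d c : 'cV[R]_n) (Q : 'M[R]_n) (a : R).

(** * Euclidean inner product, norm and quadratic forms *)

Lemma dotE u v : dot u v = \sum_i u i 0 * v i 0.
Proof. by rewrite /dot mxE; apply: eq_bigr => i _; rewrite mxE. Qed.

Lemma dotC u v : dot u v = dot v u.
Proof. by rewrite !dotE; apply: eq_bigr => i _; rewrite mulrC. Qed.

Lemma dotDr u v w : dot u (v + w) = dot u v + dot u w.
Proof. by rewrite /dot mulmxDr mxE. Qed.

Lemma dotDl u v w : dot (u + v) w = dot u w + dot v w.
Proof. by rewrite !(dotC _ w) dotDr. Qed.

Lemma dotZr a u v : dot u (a *: v) = a * dot u v.
Proof. by rewrite /dot -scalemxAr mxE. Qed.

Lemma dotZl a u v : dot (a *: u) v = a * dot u v.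
Proof. by rewrite !(dotC _ v) dotZr. Qed.

Lemma dotNr u v : dot u (- v) = - dot u v.
Proof. by rewrite -scaleN1r dotZr mulN1r. Qed.

Lemma dotNl u v : dot (- u) v = - dot u v.
Proof. by rewrite -scaleN1r dotZl mulN1r. Qed.

Lemma dot_ge0 u : 0 <= dot u u.
Proof. by rewrite dotE sumr_ge0// => i _; rewrite -expr2 sqr_ge0. Qed.

Lemma dot_eq0 u : (dot u u == 0) = (u == 0).
Proof.
apply/idP/eqP => [|->]; last by rewrite /dot mulmx0 mxE.
rewrite dotE psumr_eq0; last by move=> i _; rewrite -expr2 sqr_ge0.
move/allP => u0; apply/colP => i; rewrite mxE.
by have /= := u0 i (mem_index_enum i); rewrite mulf_eq0 orbb => /eqP.
Qed.

Lemma dot_gt0 u : (0 < dot u u) = (u != 0).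
Proof. by rewrite lt_def dot_ge0 andbT dot_eq0. Qed.

Lemma enorm_sq u : enorm u ^+ 2 = dot u u.
Proof. by rewrite /enorm sqr_sqrtr ?dot_ge0. Qed.

Lemma enorm_gt0 u : (0 < enorm u) = (u != 0).
Proof. by rewrite /enorm sqrtr_gt0 dot_gt0. Qed.

Lemma enormN u : enorm (- u) = enorm u.
Proof. by rewrite /enorm dotNl dotNr opprK. Qed.

Lemma dot_sym Q u v : Q^T = Q -> dot u (Q *m v) = dot v (Q *m u).
Proof. by move=> Qs; rewrite dotC /dot trmx_mul Qs mulmxA. Qed.

Lemma dot_shift Q a u v : dot u ((Q + a%:M) *m v) = dot u (Q *m v) + a * dot u v.
Proof. by rewrite mulmxDl mul_scalar_mx dotDr dotZr. Qed.

Lemma quad_line Q u v a : Q^T = Q ->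
  dot (u + a *: v) (Q *m (u + a *: v)) =
  dot u (Q *m u) + 2 * a * dot v (Q *m u) + a ^+ 2 * dot v (Q *m v).
Proof.
move=> Qs; rewrite mulmxDr -scalemxAr !(dotDl, dotDr, dotZl, dotZr).
by rewrite (dot_sym u v Qs); ring.
Qed.

Lemma sqnorm_line u v a :
  dot (u + a *: v) (u + a *: v) =
  dot u u + 2 * a * dot u v + a ^+ 2 * dot v v.
Proof. by rewrite !(dotDl, dotDr, dotZl, dotZr) (dotC v u); ring. Qed.


(** * Differentiation of the model along lines *)

Lemma derive_line (f : 'cV[R]_n -> R) s v :
  'D_v f s = 'D_1 (fun h : R => f (s + h *: v)) 0.
Proof.
(* Both derivatives are limits of one and the same difference quotient, once [0 + h * 1] is
   simplified. *)
rewrite /derive; set F := fun h => h^-1 *: ((f \o _) _ - _).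
set G := fun h => h^-1 *: _; suff -> : F = G by []; apply/funext => h.
by rewrite /F /G /= addr0 scale0r addr0 [h *: 1]mulr1 (addrC s).
Qed.

Lemma is_derive_quad (a b c x : R) :
  is_derive x 1 (fun h : R => a + b * h + c * h ^+ 2) (b + 2 * c * x).
Proof.
have -> : (fun h : R => a + b * h + c * h ^+ 2) =
    cst a + b *: (@id R) + c *: ((@id R) ^+ 2).
  by apply/funext => h; rewrite /= !fctE.
apply: is_derive_eq; rewrite /GRing.scale /=; ring.
Qed.

(** Chain rule: [3 (sqrt p)^2] times [dp / (2 sqrt p)]. Positivity of [p x] keeps the square root
    differentiable there. *)
Lemma is_derive_sqrt_cube (p : R -> R) (x dp : R) : 0 < p x ->
  is_derive x 1 p dp ->
  is_derive x 1 (fun h => Num.sqrt (p h) ^+ 3) (3 / 2 * Num.sqrt (p x) * dp).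
Proof.
move=> px0 pdp.
have sqrt_p := is_derive1_comp (is_derive1_sqrt px0) pdp.
have := is_deriveX 3 sqrt_p.
have -> : (Num.sqrt \o p) ^+ 3 = (fun h => Num.sqrt (p h) ^+ 3).
  by apply/funext => h; rewrite /= !fctE.
move=> /is_derive_eq; apply; rewrite /GRing.scale /=.
have : Num.sqrt (p x) != 0 by rewrite gt_eqF// sqrtr_gt0.
by move=> ?; field.
Qed.

(** On the line [s + h v] the model is a quadratic [q h] plus [sigma / 3] times the cube of
    [sqrt (p h)], where [p h] is the squared norm; [s != 0] makes [p 0] positive. *)
Lemma derive_model c Q (sigma : R) s v : Q^T = Q -> s != 0 ->
  'D_v (model c Q sigma) s = dot (c + Q *m s + (sigma * enorm s) *: s) v.
Proof.
move=> Qs s0; rewrite derive_line.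
pose p h := dot s s + 2 * dot s v * h + dot v v * h ^+ 2.
pose q h := dot c s + 2^-1 * dot s (Q *m s) +
  (dot c v + dot v (Q *m s)) * h + 2^-1 * dot v (Q *m v) * h ^+ 2.
have -> : (fun h => model c Q sigma (s + h *: v)) =
    q + (3^-1 * sigma) *: (fun h => Num.sqrt (p h) ^+ 3).
  apply/funext => h; rewrite /model /enorm sqnorm_line quad_line// !fctE.
  rewrite dotDr dotZr /q /p /GRing.scale /=.
  congr (_ + _ * Num.sqrt _ ^+ 3); [by field | by ring].
have dp : is_derive (0 : R) 1 p (2 * dot s v).
  by apply: is_derive_eq (is_derive_quad _ _ _ _) _; ring.
have dq : is_derive (0 : R) 1 q (dot c v + dot v (Q *m s)).
  by apply: is_derive_eq (is_derive_quad _ _ _ _) _; ring.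
have p0E : p 0 = dot s s by rewrite /p; ring.
have p0 : 0 < p 0 by rewrite p0E dot_gt0.
have [_ ->] := is_deriveD dq (is_deriveZ (3^-1 * sigma) (is_derive_sqrt_cube p0 dp)).
rewrite p0E -/(enorm s) !dotDl dotZl (dotC (Q *m s)) /GRing.scale /=.
by field.
Qed.

Lemma grad_model c Q (sigma : R) s : Q^T = Q -> s != 0 ->
  grad (model c Q sigma) s = c + Q *m s + (sigma * enorm s) *: s.
Proof.
move=> Qs s0; apply/colP => i; rewrite mxE derive_model// dotE.
rewrite (bigD1 i)//= big1 => [|j ji]; first by rewrite !mxE !eqxx mulr1 addr0.
by rewrite !mxE (negPf ji) mulr0.
Qed.

(** * Reflection in the hyperplane orthogonal to [d] *)

Definition reflect s d := s - (2 * (dot s d / enorm d ^+ 2)) *: d.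

Lemma enorm_reflect s d : enorm (reflect s d) = enorm s.
Proof.
have [->|d0] := eqVneq d 0; first by rewrite /reflect scaler0 subr0.
rewrite /enorm /reflect -scaleNr sqnorm_line enorm_sq; congr Num.sqrt.
have : dot d d != 0 by rewrite dot_eq0.
by move=> ?; field.
Qed.

Lemma neg_curv_neq0 Q (sigma : R) s (eps : R) d : neg_curv Q sigma s eps d -> d != 0.
Proof.
apply: contraPneq => -> /=; rewrite /neg_curv enorm_sq mulmx0 /dot mulmx0 mxE.
by rewrite mulr0 ltxx.
Qed.

(** The shift by [sigma |s|] may be inserted into both the gradient and the Hessian term: its two
    contributions sum to [sigma |s| (t (s.d) + t^2 |d|^2 / 2)], which is zero for this [t]. *)
Lemma model_reflect c Q (sigma : R) s d : Q^T = Q -> d != 0 ->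
  let t := - (2 * (dot s d / dot d d)) in
  model c Q sigma (reflect s d) = model c Q sigma s +
    t * dot (c + Q *m s + (sigma * enorm s) *: s) d +
    2^-1 * t ^+ 2 * dot d ((Q + (sigma * enorm s)%:M) *m d).
Proof.
move=> Qs d0 t; rewrite /model enorm_reflect /reflect -scaleNr enorm_sq -/t.
rewrite quad_line// dot_shift dotDr dotZr !dotDl dotZl (dotC (Q *m s)) /t.
have : dot d d != 0 by rewrite dot_eq0.
by move=> ?; field.
Qed.


(** Common core of (ii) and (iii). The change of the model is [k (H / D - g / b)] with
    [k = 2 b^2 / D > 0], and [H / D < - eps <= g / b]. *)
Lemma model_reflect_lt c Q (sigma : R) s (eps : R) d : Q^T = Q -> s != 0 ->
  neg_curv Q sigma s eps d -> dot s d != 0 ->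
  - eps <= dot (grad (model c Q sigma) s) d / dot s d ->
  model c Q sigma (reflect s d) < model c Q sigma s.
Proof.
move=> Qs s0 curv sd0; have d0 := neg_curv_neq0 curv.
rewrite grad_model// model_reflect//=; move: curv; rewrite /neg_curv enorm_sq.
set H := dot d _; set D := dot d d; set b := dot s d; set g := dot _ d.
move=> HD gb; have D0 : 0 < D by rewrite dot_gt0.
have b2 : 0 < b ^+ 2 by rewrite exprn_even_gt0.
have -> : - (2 * (b / D)) * g = - (2 * (b ^+ 2 / D)) * (g / b).
  by field; rewrite sd0 gt_eqF.
have -> : 2^-1 * (- (2 * (b / D))) ^+ 2 * H = 2 * (b ^+ 2 / D) * (H / D).
  by field; rewrite gt_eqF.
have k0 : 0 < 2 * (b ^+ 2 / D) by rewrite mulr_gt0// divr_gt0.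
have HDlt : H / D < - eps by rewrite ltr_pdivrMr.
rewrite -addrA gtrDl mulNr addrC subr_lt0 ltr_pM2l//.
exact: lt_le_trans HDlt gb.
Qed.

(** Provides the sufficiently large [alpha] of (iii). Beyond the witness,
    [x C + |A| + 2 |B| <= C < 0]; multiplying by [x >= 1] dominates [A] and [2 x B]. *)
Lemma quad_eventually_neg (A B C : R) : C < 0 ->
  exists x0, forall x, x0 <= x -> A + 2 * x * B + x ^+ 2 * C < 0.
Proof.
move=> C0; exists (1 + (`|A| + 2 * `|B|) / - C) => x.
set y := _ / - C => yx.
have yC : y * - C = `|A| + 2 * `|B| by rewrite mulfVK// oppr_eq0 lt_eqF.
have y0 : 0 <= y by rewrite divr_ge0 ?addr_ge0 ?mulr_ge0// oppr_ge0 ltW.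
have x1 : 1 <= x by lra.
have xC : x * C + (`|A| + 2 * `|B|) < 0 by nra.
have xxC : x * (x * C + (`|A| + 2 * `|B|)) < 0 by nra.
have AxA : A <= x * `|A|.
  by rewrite (le_trans (ler_norm A))// ler_peMl.
have xB : x * B <= x * `|B| by rewrite ler_wpM2l ?ler_norm//; lra.
by rewrite expr2; nra.
Qed.

End CubicModel.

Theorem theorem3 (R : realType) (n : nat) (c : 'cV[R]_n) (Q : 'M[R]_n)
    (sigma : R) (sbar : 'cV[R]_n)
    (Qsym : Q^T = Q) (sigma_gt0 : 0 < sigma) :
  let m := model c Q sigma in
  let g := grad m sbar in
  (* (a) *)
  (0 < dot c sbar -> m (- sbar) < m sbar) /\
  (* (b) *)
  (dot c sbar <= 0 ->
   forall (eps2 : R) (d0 : 'cV[R]_n), neg_curv Q sigma sbar eps2 d0 ->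
   (* (i) *)
   (sbar = 0 -> 0 <= eps2 ->
    forall d : 'cV[R]_n, d = d0 \/ d = - d0 -> dot c d <= 0 ->
    let alpha_max := - (3 * dot d (Q *m d)) / (2 * sigma * enorm d ^+ 3) in
    0 < alpha_max /\
    forall alpha : R, 0 < alpha -> alpha < alpha_max ->
    m (sbar + alpha *: d) < m sbar) /\
   (* (ii) *)
   (sbar != 0 -> dot sbar d0 != 0 ->
    `|dot g d0 / dot sbar d0| <= eps2 ->
    m (sbar - (2 * (dot sbar d0 / enorm d0 ^+ 2)) *: d0) < m sbar) /\
   (* (iii) *)
   (sbar != 0 -> dot sbar d0 = 0 ->
    `|dot g sbar| / enorm sbar ^+ 2 < eps2 ->
    forall d : 'cV[R]_n, d = d0 \/ d = - d0 -> 0 <= dot g d ->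
    (exists alpha0 : R, forall alpha : R, alpha0 <= alpha ->
       neg_curv Q sigma sbar eps2 (sbar + alpha *: d)) /\
    forall alpha : R, 0 < alpha ->
    let z := sbar + alpha *: d in
    neg_curv Q sigma sbar eps2 z ->
    m (sbar - (2 * (dot sbar z / enorm z ^+ 2)) *: z) < m sbar)).
Proof.
move=> m g; split=> [cs|_ eps2 d0 curv0].
  (* Under negation only the linear term changes, and it turns from positive to negative. *)
  by rewrite /m /model enormN mulmxN !(dotNl, dotNr) opprK !ltrD2r gtrN.
(* The curvature condition is even in [d], so it survives the choice of sign. *)
have curv_pm d : d = d0 \/ d = - d0 -> neg_curv Q sigma sbar eps2 d.
  by case=> ->//; rewrite /neg_curv enormN mulmxN !(dotNl, dotNr) opprK.
split; last split.
- move=> s0 eps_ge0 d /curv_pm curv cd; subst sbar.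
  have d_neq0 := neg_curv_neq0 curv.
  move: curv; rewrite /neg_curv dot_shift (_ : enorm 0 = 0); last first.
    by rewrite /enorm /dot mulmx0 mxE sqrtr0.
  rewrite mulr0 mul0r addr0 => curv.
  have e0 : 0 < enorm d by rewrite enorm_gt0.
  have q0 : dot d (Q *m d) < 0.
    by apply: lt_le_trans curv _; rewrite mulNr oppr_le0 mulr_ge0// sqr_ge0.
  have k0 : 0 < 2 * sigma * enorm d ^+ 3 by rewrite !mulr_gt0// exprn_gt0.
  split; first by rewrite divr_gt0// oppr_gt0 pmulr_rlt0.
  move=> a a0; rewrite ltr_pdivlMr// => ak.
  have m0 : m 0 = 0.
    by rewrite /m /model /enorm mulmx0 /dot !mulmx0 mxE sqrtr0 expr0n/= !mulr0 !addr0.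
  rewrite add0r m0 /m /model -scalemxAr !(dotZl, dotZr).
  have -> : enorm (a *: d) = a * enorm d.
    by rewrite /enorm dotZl dotZr mulrA -expr2 sqrtrM ?sqr_ge0// sqrtr_sqr gtr0_norm.
  rewrite exprMn.
  (* Factoring out [a^2 / 6] leaves a bracket that is negative precisely when [a] is below
     [alpha_max]. *)
  have -> : a * dot c d + 2^-1 * (a * (a * dot d (Q *m d))) +
      3^-1 * sigma * (a ^+ 3 * enorm d ^+ 3) =
    a * dot c d + a ^+ 2 / 6 *
      (a * (2 * sigma * enorm d ^+ 3) - (- (3 * dot d (Q *m d)))) by field.
  rewrite -ltrBrDl sub0r.
  apply: (@lt_le_trans _ _ 0); last by rewrite oppr_ge0 pmulr_rle0.
  by rewrite pmulr_rlt0 ?subr_lt0// divr_gt0// exprn_gt0.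
- move=> s0 sd0; rewrite ler_norml => /andP[geps _].
  exact: model_reflect_lt curv0 sd0 geps.
- move=> s0 sd0 geps d dE gd0.
  have sd : dot sbar d = 0 by case: dE => ->; rewrite ?dotNr sd0 ?oppr0.
  have curv := curv_pm d dE; split.
    set M := Q + (sigma * enorm sbar)%:M.
    have MT : M^T = M by rewrite /M linearD /= Qsym tr_scalar_mx.
    (* This is the leading coefficient, as a quadratic in [alpha], of the curvature condition at
       [sbar + alpha d]; as [sbar.d = 0], the squared norm adds nothing to the linear one. *)
    have C0 : dot d (M *m d) + eps2 * dot d d < 0.
      by move: curv; rewrite /neg_curv enorm_sq mulNr -subr_lt0 opprK.
    have [x0 x0P] := quad_eventually_neg (dot sbar (M *m sbar) + eps2 * dot sbar sbar)
      (dot d (M *m sbar)) C0.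
    exists x0 => x /x0P; rewrite /neg_curv -/M enorm_sq quad_line// sqnorm_line sd.
    by lra.
  move=> a a0 z curvz.
  have ss0 : 0 < dot sbar sbar by rewrite dot_gt0.
  have sz : dot sbar z = dot sbar sbar by rewrite dotDr dotZr sd mulr0 addr0.
  apply: (model_reflect_lt (eps := eps2)) => //; first by rewrite sz gt_eqF.
  rewrite sz -/m -/g dotDr dotZr.
  (* The remaining bound is [g.z = g.s + a (g.d) >= g.s >= - |g.s| > - eps2 |s|^2], with [s] for
     [sbar]. *)
  have : - `|dot g sbar| <= dot g sbar by rewrite lerNl -normrN ler_norm.
  move: geps; rewrite enorm_sq ltr_pdivrMr// ler_pdivlMr// => geps gs.
  have := mulr_ge0 (ltW a0) gd0; lra.
Qed.
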